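(* Let $P_1P_2P_3$ be a right triangle in the Euclidean plane with right angle at $P_1$, and let $l_i$ be the length of the side opposite $P_i$, $i=1,2,3$. Let $P$ be the midpoint of the altitude from $P_1$ to the hypotenuse $P_2P_3$. For every real $k>0$, let $P_1'P_2'P_3'$ be the enveloping triangle associated with the sagittae $f_i=l_i/k$, $i=1,2,3$. Then there is a homothety with centre $P$ that maps the triangle $P_1P_2P_3$ to $P_1'P_2'P_3'$, with $P_i\mapsto P_i'$. In particular the centre $P$ is the same for all $k$.
   Context: The sagitta of length $f_i$ on the side opposite $P_i$ is the segment of length $f_i$ that starts at the midpoint of that side, is perpendicular to the side, and points to the exterior of the triangle (it is the sagitta of an arc whose chord is that side and which is symmetric with respect to the perpendicular bisector of the side). The enveloping triangle $P_1'P_2'P_3'$ is the triangle whose three side lines are the lines parallel to the sides of $P_1P_2P_3$ through the outer endpoints of the three sagittae. Its vertices are labelled so that the side opposite $P_i'$ is parallel to the side opposite $P_i$. The point $P$ is called the Pythagorean centre. *)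

(* Defs.v *)
From mathcomp Require Import all_boot all_order all_algebra.
From mathcomp Require Import boolp classical_sets reals.
From mathcomp Require Import ring lra.
Set Implicit Arguments.
Unset Strict Implicit.
Unset Printing Implicit Defensive.
Import Order.TTheory GRing.Theory Num.Theory.
Local Open Scope classical_set_scope.
Local Open Scope ring_scope.

Section Plane.
Variable R : realType.
Implicit Types (A B C Q D u v x : 'rV[R]_2).

Definition dot u v : R := (u *m v^T) 0 0.

(* The norm `|u| of mathcomp-analysis on row vectors is the sup norm, hence
   the explicit Euclidean norm. *)
Definition enorm u : R := Num.sqrt (dot u u).

Definition line_dir A u : set 'rV[R]_2 := [set x | exists t : R, x = A + t *: u].

Definition midpoint A B : 'rV[R]_2 := 2^-1 *: (A + B).

Definition homothety C (r : R) x : 'rV[R]_2 := C + r *: (x - C).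

(* The vertices P_1, P_2, P_3 are P 0, P 1, P 2.  Indices are added modulo 3
   in 'I_3, so the side opposite P i joins P (i + 1) and P (i + 2). *)
Implicit Types (P : 'I_3 -> 'rV[R]_2) (f : 'I_3 -> R) (i : 'I_3).

Definition affinely_independent P : bool :=
  row_free (\matrix_(j < 2) (P (lift 0 j) - P 0)).

Definition right_triangle P : Prop :=
  affinely_independent P /\ dot (P 1 - P 0) (P 2 - P 0) = 0.

Definition triangle_region P : set 'rV[R]_2 :=
  [set x | exists w : 'I_3 -> R,
     [/\ forall i, 0 <= w i, \sum_i w i = 1 & x = \sum_i w i *: P i]].

Definition side_vec P i : 'rV[R]_2 := P (i + 2) - P (i + 1).

Definition side_line P i : set 'rV[R]_2 := line_dir (P (i + 1)) (side_vec P i).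

Definition side_length P i : R := enorm (side_vec P i).

Definition side_midpoint P i : 'rV[R]_2 := midpoint (P (i + 1)) (P (i + 2)).

Definition altitude_foot P i D : Prop :=
  side_line P i D /\ dot (D - P i) (side_vec P i) = 0.

(* Q is the outer endpoint of the sagitta of length ell on the side opposite
   P i; the last clause says that the sagitta, except for its foot, lies
   outside the (closed, filled) triangle. *)
Definition sagitta_end P i (ell : R) Q : Prop :=
  let M := side_midpoint P i in
  [/\ dot (Q - M) (side_vec P i) = 0,
      enorm (Q - M) = ell &
      forall t : R, 0 < t <= 1 -> ~ triangle_region P (M + t *: (Q - M))].

Definition enveloping_triangle P f P' : Prop :=
  affinely_independent P' /\
  exists Q : 'I_3 -> 'rV[R]_2,
    forall i, sagitta_end P i (f i) (Q i) /\
              side_line P' i = line_dir (Q i) (side_vec P i).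

Lemma dotE u v : dot u v = u 0 0 * v 0 0 + u 0 1 * v 0 1.
Proof.
rewrite /dot mxE big_ord_recl big_ord1 !mxE.
by congr (_ + u _ _ * v _ _); apply/val_inj.
Qed.

Lemma dotBl u v x : dot (u - v) x = dot u x - dot v x.
Proof. by rewrite /dot mulmxBl !mxE. Qed.

Lemma dotDl u v x : dot (u + v) x = dot u x + dot v x.
Proof. by rewrite /dot mulmxDl !mxE. Qed.

Lemma dotZl (a : R) u v : dot (a *: u) v = a * dot u v.
Proof. by rewrite /dot -scalemxAl !mxE. Qed.

Lemma dotC u v : dot u v = dot v u.
Proof. by rewrite !dotE; ring. Qed.

Lemma enormZ (a : R) u : enorm (a *: u) = `|a| * enorm u.
Proof.
rewrite /enorm dotZl dotC dotZl mulrA -expr2 sqrtrM ?sqr_ge0//.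
by rewrite sqrtr_sqr.
Qed.

Definition cross u v : R := u 0 0 * v 0 1 - u 0 1 * v 0 0.

Lemma ord3_cases i : [\/ i = 0, i = 1 | i = 2].
Proof.
by case: i => -[|[|[|//]]] h; [apply: Or31|apply: Or32|apply: Or33];
  apply/val_inj.
Qed.

Lemma ord3_add :
  (((0 + 1 = 1 :> 'I_3) * (0 + 2 = 2 :> 'I_3)) *
   ((1 + 1 = 2 :> 'I_3) * (1 + 2 = 0 :> 'I_3)) *
   ((2 + 1 = 0 :> 'I_3) * (2 + 2 = 1 :> 'I_3))).
Proof. by do !split; apply/val_inj. Qed.

Lemma sum3 (V : zmodType) (F : 'I_3 -> V) i :
  \sum_j F j = F i + F (i + 1) + F (i + 2).
Proof.
have -> : \sum_j F j = F 0 + F 1 + F 2.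
  rewrite !big_ord_recl big_ord0 addr0 addrA.
  by congr (_ + F _ + F _); apply/val_inj.
case: (ord3_cases i) => ->; rewrite !ord3_add //.
- by rewrite -addrA addrC.
- by rewrite addrC addrA.
Qed.

Lemma affinely_independentE P :
  affinely_independent P = (cross (P 1 - P 0) (P 2 - P 0) != 0).
Proof.
rewrite /affinely_independent row_free_unit unitmxE unitfE.
rewrite (expand_det_row _ 0) big_ord_recl big_ord1 /cofactor !det_mx11.
have e1 : lift 0 (0 : 'I_2) = 1 :> 'I_3 by apply/val_inj.
have e2 : lift 0 (1 : 'I_2) = 2 :> 'I_3 by apply/val_inj.
have e3 : lift (lift 0 0) 0 = 0 :> 'I_2 by apply/val_inj.
have e4 : lift 0 0 = 1 :> 'I_2 by apply/val_inj.
rewrite !mxE /= e3 e4 e1 e2 /cross; congr (_ != 0); rewrite !mxE /=.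
by ring.
Qed.

Lemma cross_cyclic P i :
  cross (side_vec P i) (P i - P (i + 1)) = cross (P 1 - P 0) (P 2 - P 0).
Proof.
rewrite /cross /side_vec.
by case: (ord3_cases i) => ->; rewrite !ord3_add !mxE; ring.
Qed.

Lemma altitude_foot_exists P i : affinely_independent P ->
  exists2 D, altitude_foot P i D & 0 < enorm (P i - D).
Proof.
rewrite affinely_independentE -(cross_cyclic P i) => c0.
set d := side_vec P i in c0 *.
set e := P i - P (i + 1) in c0 *.
have d0 : dot d d != 0.
  apply: contra_neq c0; rewrite dotE => h.
  have h0 : d 0 0 = 0 by nra.
  have h1 : d 0 1 = 0 by nra.
  by rewrite /cross h0 h1; ring.
pose s := dot d e / dot d d.
have ec : dot (e - s *: d) (e - s *: d) * dot d d = cross d e ^+ 2.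
  have -> : dot (e - s *: d) (e - s *: d)
      = dot e e - 2 * s * dot d e + s ^+ 2 * dot d d.
    by rewrite !dotE !mxE; ring.
  have -> : cross d e ^+ 2 = dot e e * dot d d - dot d e ^+ 2.
    by rewrite !dotE /cross; ring.
  by rewrite /s; field.
exists (P (i + 1) + s *: d).
  split; first by exists s.
  have -> : P (i + 1) + s *: d - P i = s *: d - e.
    by rewrite /e; apply/rowP => j; rewrite !mxE; ring.
  by rewrite dotBl dotZl /s [dot e d]dotC; field.
have -> : P i - (P (i + 1) + s *: d) = e - s *: d by rewrite opprD addrA.
rewrite /enorm sqrtr_gt0.
have dge : 0 <= dot d d by rewrite dotE; nra.
have : 0 < dot (e - s *: d) (e - s *: d) * dot d d.
  by rewrite ec exprn_even_gt0.
by rewrite pmulr_lgt0 // lt_def d0.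
Qed.

Lemma enveloping_triangle_exists P f : affinely_independent P ->
  (forall i, 0 < f i) -> exists P', enveloping_triangle P f P'.
Proof.
move=> Pi f0.
have /choice[D hD] : forall i, exists D,
    altitude_foot P i D /\ 0 < enorm (P i - D).
  by move=> i; have [D ? ?] := altitude_foot_exists i Pi; exists D.
pose h i := enorm (P i - D i).
pose u i := f i / h i.
have u0 i : 0 < u i by rewrite divr_gt0 ?f0 //; case: (hD i).
pose U := \sum_i u i.
have U0 : 0 < 1 + U by rewrite ltr_wpDr // sumr_ge0 // => i _; exact: ltW.
pose P' j := (1 + U) *: P j - \sum_i u i *: P i.
have PB a b : P' a - P' b = (1 + U) *: (P a - P b).
  by rewrite /P' scalerBr; apply/rowP => k; rewrite !mxE; ring.
exists P'; split.
  move: Pi; rewrite !affinely_independentE !PB => c0.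
  have -> : cross ((1 + U) *: (P 1 - P 0)) ((1 + U) *: (P 2 - P 0)) =
      (1 + U) ^+ 2 * cross (P 1 - P 0) (P 2 - P 0).
    by rewrite /cross !mxE; ring.
  by rewrite mulf_neq0 // expf_neq0 // gt_eqF.
exists (fun i => side_midpoint P i - u i *: (P i - D i)) => i.
have [[[s Ds] Dperp] hpos] := hD i.
have nd : dot (P i - D i) (side_vec P i) = 0.
  by rewrite -opprB -scaleN1r dotZl Dperp mulr0.
have QM : side_midpoint P i - u i *: (P i - D i) - side_midpoint P i
    = (- u i) *: (P i - D i) by rewrite addrC addKr scaleNr.
split; first split.
- by rewrite QM dotZl nd mulr0.
- by rewrite QM enormZ normrN gtr0_norm // /u divfK // gt_eqF.
- move=> t /andP[t0 _] [w [w0 w1 xw]].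
  set n := P i - D i in nd QM *.
  have nn : 0 < dot n n by rewrite -sqrtr_gt0.
  have : dot (side_midpoint P i + t *: ((- u i) *: n) - P (i + 1)) n
       = - (t * u i * dot n n).
    have -> : side_midpoint P i + t *: ((- u i) *: n) - P (i + 1) =
       2^-1 *: side_vec P i + (- (t * u i)) *: n.
      by apply/rowP => k; rewrite !mxE; field.
    by rewrite dotDl !dotZl [dot (side_vec _ _) _]dotC nd; ring.
  rewrite -QM xw (sum3 _ i).
  have w1' : w (i + 1) = 1 - w i - w (i + 2).
    by rewrite -w1 (sum3 _ i); ring.
  have -> : w i *: P i + w (i + 1) *: P (i + 1) + w (i + 2) *: P (i + 2)
     - P (i + 1) = w i *: n + (w i * s + w (i + 2)) *: side_vec P i.
    rewrite w1' /n Ds; apply/rowP => k; rewrite !mxE; ring.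
  rewrite dotDl !dotZl [dot (side_vec _ _) _]dotC nd mulr0 addr0 => eq.
  have : 0 <= w i * dot n n by rewrite mulr_ge0 // ltW.
  by rewrite eq oppr_ge0 leNgt (mulr_gt0 (mulr_gt0 t0 (u0 i)) nn).
- have sv : side_vec P' i = (1 + U) *: side_vec P i by rewrite /side_vec PB.
  pose c := 2^-1 + u i * s + u (i + 2).
  have QP : side_midpoint P i - u i *: (P i - D i)
      = P' (i + 1) + c *: side_vec P i.
    rewrite /P' /c /U Ds !(sum3 _ i); apply/rowP => k; rewrite !mxE; by field.
  have U0' : 1 + U != 0 by rewrite gt_eqF.
  rewrite /side_line sv QP; apply/seteqP; split=> x [t ->].
    by exists (t * (1 + U) - c); apply/rowP => k; rewrite !mxE; ring.
  exists ((t + c) / (1 + U)); apply/rowP => k; rewrite !mxE; by field.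
Qed.

End Plane.

(* Main.v *)
Require Import Defs.
From mathcomp Require Import all_boot all_order all_algebra.
From mathcomp Require Import boolp classical_sets reals.
From mathcomp Require Import ring lra.
Import Order.TTheory GRing.Theory Num.Theory.
Local Open Scope classical_set_scope.
Local Open Scope ring_scope.

(** Write [c] for twice the signed area of [P], and [d_i], [M_i], [l_i] for the
    vector, midpoint and length of side [i].
    The sagitta on side [i] has signed distance [- sg c * f_i] from that side,
    so each vertex [P' j] satisfies two linear equations
    [cross d_i (P' j - M_i) = - sg c * l_i ^ 2 / k], [i != j], which determine
    it.  The homothety of ratio [r] and centre [C] satisfies them as soon as
    [(r - 1) * cross d_i (C - M_i) = sg c * l_i ^ 2 / k] for all [i].  So [C]
    must have distance to side [i] proportional to [l_i], and for a right
    triangle the midpoint of the altitude has this property: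
    its barycentric coordinates are [l_i ^ 2 / (2 l_0 ^ 2)]. *)

Lemma rowP2 (R : realType) (u v : 'rV[R]_2) :
  u 0 0 = v 0 0 -> u 0 1 = v 0 1 -> u = v.
Proof.
move=> e0 e1; apply/rowP => -[[|[|//]] h].
- by rewrite (_ : Ordinal h = 0) //; apply/val_inj.
- by rewrite (_ : Ordinal h = 1) //; apply/val_inj.
Qed.

(** Cramer's identity [cross u v *: x = cross u x *: v - cross v x *: u], read in each
    coordinate. *)
Lemma cross_nondegenerate (R : realType) (u v x : 'rV[R]_2) :
  cross u v != 0 -> cross u x = 0 -> cross v x = 0 -> x = 0.
Proof.
move=> c0 ux vx; apply: rowP2; rewrite mxE; apply: (mulfI c0); rewrite mulr0.
- rewrite (_ : _ * _ = v 0 0 * cross u x - u 0 0 * cross v x).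
    by rewrite ux vx !mulr0 subr0.
  by rewrite /cross; ring.
- rewrite (_ : _ * _ = v 0 1 * cross u x - u 0 1 * cross v x).
    by rewrite ux vx !mulr0 subr0.
  by rewrite /cross; ring.
Qed.

Section SignedArea.
Variables (R : realType) (P : 'I_3 -> 'rV[R]_2).
Let c := cross (P 1 - P 0) (P 2 - P 0).

(** The barycentric coordinates of [x] are the cross products divided by [c]. Multiplying by [c]
    instead makes the condition independent of the orientation and of division. *)
Lemma triangle_region_cross (x : 'rV[R]_2) : c != 0 ->
  (forall j, 0 <= cross (side_vec P j) (x - P (j + 1)) * c) ->
  triangle_region P x.
Proof.
move=> c0 xc; exists (fun j => cross (side_vec P j) (x - P (j + 1)) / c).
split=> [j||].
- have c2 : 0 < c ^+ 2 by rewrite exprn_even_gt0.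
  rewrite (_ : _ / _ = cross (side_vec P j) (x - P (j + 1)) * c / c ^+ 2).
    by rewrite divr_ge0 ?xc // ltW.
  by field.
- rewrite (sum3 _ 0) -!mulrDl.
  apply: (mulIf c0); rewrite divfK // mul1r.
  by rewrite /c /cross /side_vec !ord3_add !mxE; ring.
- have E n0 n1 n2 (a0 a1 a2 : R) : n0 / c * a0 + n1 / c * a1 + n2 / c * a2 =
      (n0 * a0 + n1 * a1 + n2 * a2) / c by ring.
  rewrite (sum3 _ 0); apply: rowP2; rewrite !mxE E;
  apply: (mulIf c0); rewrite divfK //;
  by rewrite /c /cross /side_vec !ord3_add !mxE; ring.
Qed.

Lemma cross_side_midpoint (i j : 'I_3) :
  cross (side_vec P j) (side_midpoint P i - P (j + 1)) =
    if j == i then 0 else c / 2.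
Proof.
rewrite /c /cross /side_midpoint /midpoint /side_vec.
by case: (ord3_cases i) => ->; case: (ord3_cases j) => ->;
  rewrite !ord3_add !mxE /=; field.
Qed.

(** Otherwise a short step from the midpoint towards [Q] would stay in the triangle: the coordinate
    at [i] does not drop below 0, and the other two start at 1/2. *)
Lemma sagitta_end_outward (i : 'I_3) (ell : R) (Q : 'rV[R]_2) :
  c != 0 -> sagitta_end P i ell Q ->
  cross (side_vec P i) (Q - side_midpoint P i) * c < 0.
Proof.
move=> c0 [_ _ out]; rewrite ltNge; apply/negP => gc.
set M := side_midpoint P i in out gc *.
set g := Q - M in out gc *.
pose b j := cross (side_vec P j) g * c.
pose s := \sum_j `|b j|.
have bs j : `|b j| <= s.
  by rewrite /s (bigD1 j) //= lerDl sumr_ge0 // => l _; rewrite normr_ge0.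
have s0 : 0 <= s by rewrite sumr_ge0.
have c2 : 0 < c ^+ 2 by rewrite exprn_even_gt0.
have e0 : 0 < c ^+ 2 + 2 * s by lra.
(* This choice gives [0 < t <= 1] and [t * s <= c ^+ 2 / 2], so no displacement [t * b j] outweighs
   the value [c / 2 * c] at the midpoint. It also covers [s = 0]. *)
pose t := c ^+ 2 / (c ^+ 2 + 2 * s).
have t0 : 0 < t by rewrite divr_gt0.
have te : t * (c ^+ 2 + 2 * s) = c ^+ 2 by rewrite divfK // gt_eqF.
apply: (out t); first by rewrite t0 ler_pdivrMr //= mul1r; lra.
apply: triangle_region_cross => // j.
have -> : cross (side_vec P j) (M + t *: g - P (j + 1)) * c =
    cross (side_vec P j) (M - P (j + 1)) * c + t * b j.
  by rewrite /b /cross !mxE; ring.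
rewrite cross_side_midpoint; case: eqP => [->|_].
  by rewrite mul0r add0r mulr_ge0 // ltW.
have : t * - b j <= t * s.
  by rewrite ler_pM2l //; apply: le_trans (bs j); rewrite -normrN ler_norm.
have : 0 <= t * c ^+ 2 by rewrite mulr_ge0 ?ltW.
by lra.
Qed.

Lemma dot_ge0 (u : 'rV[R]_2) : 0 <= dot u u.
Proof. by rewrite dotE -!expr2 addr_ge0 ?sqr_ge0. Qed.

Lemma sqr_enorm (u : 'rV[R]_2) : enorm u ^+ 2 = dot u u.
Proof. by rewrite sqr_sqrtr ?dot_ge0. Qed.

Lemma sagitta_end_cross (i : 'I_3) (ell : R) (Q : 'rV[R]_2) :
  c != 0 -> sagitta_end P i ell Q ->
  cross (side_vec P i) (Q - side_midpoint P i) =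
    - (Num.sg c * (side_length P i * ell)).
Proof.
move=> c0 sQ; have := sagitta_end_outward _ _ _ c0 sQ.
case: sQ => perp <- _; rewrite /side_length.
set g := Q - _ in perp *; set d := side_vec P i in perp * => gc.
have e : cross d g ^+ 2 = (enorm d * enorm g) ^+ 2.
  (* Lagrange's identity: the zero that is added is the square of the dot product. *)
  rewrite exprMn !sqr_enorm -[LHS]addr0 -[X in _ + X](expr0n _ 2) -perp.
  by rewrite /cross !dotE; ring.
have : `|cross d g| = enorm d * enorm g.
  apply/eqP; rewrite -(@eqrXn2 _ 2) ?normr_ge0 //.
  - by rewrite real_normK ?num_real // e.
  - by rewrite mulr_ge0 // sqrtr_ge0.
move=> <-; move: gc; case: (ltrgtP c 0) c0 => // cs _.
  by rewrite nmulr_llt0 // => x0; rewrite ltr0_sg // gtr0_norm // mulN1r opprK.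
by rewrite pmulr_llt0 // => x0; rewrite gtr0_sg // ltr0_norm // mul1r opprK.
Qed.

End SignedArea.

(** [P' j] lies on the parallel to side [i] through [Q i], and the cross product with [side_vec P i]
    is constant along that line. *)
Lemma enveloping_triangle_cross (R : realType) (P P' : 'I_3 -> 'rV[R]_2)
    (f : 'I_3 -> R) (i j : 'I_3) :
  affinely_independent P -> enveloping_triangle P f P' -> j != i ->
  cross (side_vec P i) (P' j - side_midpoint P i) =
    - (Num.sg (cross (P 1 - P 0) (P 2 - P 0)) * (side_length P i * f i)).
Proof.
rewrite affinely_independentE => c0 [_ [Q /(_ i) [sQ lQ]]] ji.
have [t ->] : line_dir (Q i) (side_vec P i) (P' j).
  rewrite -lQ /side_line.
  have [->|->] : j = i + 1 \/ j = i + 2.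
    move: ji; case: (ord3_cases i) => ->; case: (ord3_cases j) => ->;
      rewrite ?eqxx // !ord3_add; by [left|right].
  - by exists 0; rewrite scale0r addr0.
  - by exists 1; rewrite scale1r /side_vec [RHS]addrC subrK.
rewrite -(sagitta_end_cross _ _ _ _ _ c0 sQ).
by rewrite /cross !mxE; ring.
Qed.

Lemma homothety_triangle_region (R : realType) (P P' : 'I_3 -> 'rV[R]_2)
    (C : 'rV[R]_2) (r : R) :
  (forall i, homothety C r (P i) = P' i) ->
  homothety C r @` triangle_region P = triangle_region P'.
Proof.
move=> H.
have comb (w : 'I_3 -> R) : \sum_i w i = 1 ->
    homothety C r (\sum_i w i *: P i) = \sum_i w i *: P' i.
  rewrite !(sum3 _ 0) !ord3_add => w1; rewrite -!H /homothety.
  have -> : w 0 = 1 - w 1 - w 2 by rewrite -w1; ring.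
  by apply/rowP => l; rewrite !mxE; ring.
apply/seteqP; split=> [_ [_ [w [w0 w1 ->]] <-]|_ [w [w0 w1 ->]]].
  by exists w; split=> //; exact: comb.
by exists (\sum_i w i *: P i); [exists w|exact: comb].
Qed.

Lemma cross_altitude_midpoint (R : realType) (P : 'I_3 -> 'rV[R]_2)
    (D : 'rV[R]_2) (i : 'I_3) :
  right_triangle P -> altitude_foot P 0 D ->
  2 * side_length P 0 ^+ 2 *
    cross (side_vec P i) (midpoint (P 0) D - side_midpoint P i) =
  cross (P 1 - P 0) (P 2 - P 0) * side_length P i ^+ 2.
Proof.
move=> [_ uv] [[s Ds] perp]; rewrite /side_length !sqr_enorm.
set u := P 1 - P 0 in uv *; set v := P 2 - P 0 in uv *.
have d0 : side_vec P 0 = v - u.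
  by rewrite /side_vec !ord3_add /u /v; apply/rowP => l; rewrite !mxE; ring.
have d1 : side_vec P 1 = - v by rewrite /side_vec !ord3_add opprB.
have d2 : side_vec P 2 = u by rewrite /side_vec !ord3_add.
have Du : D - P 0 = u + s *: (v - u).
  by rewrite Ds d0 !ord3_add /u addrAC.
have P1u : P 1 = P 0 + u by rewrite /u [RHS]addrC subrK.
have P2v : P 2 = P 0 + v by rewrite /v [RHS]addrC subrK.
have DE : D = P 0 + u + s *: (v - u) by rewrite -addrA -Du [RHS]addrC subrK.
have l0 : dot (v - u) (v - u) = dot u u + dot v v.
  rewrite -[RHS]subr0 -(mulr0 2) -uv !dotE !mxE; ring.
(* Leg theorem: the foot of the altitude divides the hypotenuse in the ratio of the squared legs.
   Both [perp] and [uv] enter. *)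
have su : s * (dot u u + dot v v) = dot u u.
  apply/eqP; rewrite -subr_eq0 -l0; apply/eqP.
  transitivity (dot (D - P 0) (side_vec P 0) - dot u v); last by rewrite perp uv subrr.
  by rewrite Du d0 !dotE !mxE; ring.
clearbody u v.
case: (ord3_cases i) => ->.
- rewrite d0 l0 /side_midpoint /midpoint !ord3_add DE P1u P2v /cross !mxE.
  by field.
- rewrite d0 d1 l0.
  have -> : cross (- v) (midpoint (P 0) D - side_midpoint P 1) =
     (1 - s) / 2 * cross u v.
    rewrite /side_midpoint /midpoint !ord3_add DE P2v /cross !mxE.
    by field.
  have -> : dot (- v) (- v) = (1 - s) * (dot u u + dot v v).
    by rewrite mulrBl mul1r su !dotE !mxE; ring.
  by field.
- rewrite d0 d2 l0.
  have -> : cross u (midpoint (P 0) D - side_midpoint P 2) = s / 2 * cross u v.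
    rewrite /side_midpoint /midpoint !ord3_add DE P1u /cross !mxE.
    by field.
  by rewrite -[in RHS]su; field.
Qed.

Theorem mainTheorem2 (R : realType) (P : 'I_3 -> 'rV[R]_2) (D : 'rV[R]_2)
    (hP : right_triangle P) (hD : altitude_foot P 0 D) :
  forall k : R, 0 < k ->
  forall P' : 'I_3 -> 'rV[R]_2,
  enveloping_triangle P (fun i => side_length P i / k) P' ->
  exists2 r : R, r != 0 &
    (forall i : 'I_3, homothety (midpoint (P 0) D) r (P i) = P' i) /\
    homothety (midpoint (P 0) D) r @` triangle_region P = triangle_region P'.
Proof.
move=> k k0 P' env; have aP := hP.1.
have c0 := aP; rewrite affinely_independentE in c0.
set C := midpoint (P 0) D; set c := cross _ _ in c0.
(* The solution of the equations for the ratio, using [c = Num.sg c * |c|]; the sign of [c] cancels,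
   so [r > 1] for both orientations. *)
pose r := 1 + 2 * side_length P 0 ^+ 2 / (k * `|c|).
have kc0 : 0 < k * `|c| by rewrite mulr_gt0 // normr_gt0.
have r0 : r != 0.
  by rewrite gt_eqF // ltr_wpDr // divr_ge0 ?(ltW kc0) // mulr_ge0 // sqr_ge0.
have ratio i : (r - 1) * cross (side_vec P i) (C - side_midpoint P i) =
    Num.sg c * (side_length P i * (side_length P i / k)).
  rewrite /r addrC addKr mulrAC cross_altitude_midpoint // -/c.
  have n0 : `|c| != 0 by rewrite normr_eq0.
  have k1 : k != 0 by rewrite gt_eqF.
  rewrite [X in X * _ / _](numEsg c); field.
  by rewrite n0 k1.
have eqn i j : j != i ->
    cross (side_vec P i) (homothety C r (P j) - P' j) = 0.
  move=> ji.
  (* The homothety is affine, so signed distances to side [i] combine with weights [r] and [1 - r];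
     that of [P j] vanishes. *)
  have -> : cross (side_vec P i) (homothety C r (P j) - P' j) =
      r * cross (side_vec P i) (P j - side_midpoint P i)
      - (r - 1) * cross (side_vec P i) (C - side_midpoint P i)
      - cross (side_vec P i) (P' j - side_midpoint P i).
    by rewrite /homothety /cross !mxE; ring.
  rewrite ratio (enveloping_triangle_cross _ _ _ _ _ _ aP env ji) -/c.
  have -> : cross (side_vec P i) (P j - side_midpoint P i) = 0.
    move: ji; rewrite /cross /side_vec /side_midpoint /midpoint.
    case: (ord3_cases i) => ->; case: (ord3_cases j) => ->;
      rewrite ?eqxx // !ord3_add !mxE => _; by field.
  by ring.
have H i : homothety C r (P i) = P' i.
  apply/eqP; rewrite -subr_eq0; apply/eqP.
  (* The vertex [P' i] is determined by the two sides through it, whose directions have cross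
     product [c]. *)
  apply: (@cross_nondegenerate _ (side_vec P (i + 1)) (side_vec P (i + 2))).
  - rewrite (_ : cross _ _ = c) // /c /cross /side_vec.
    by case: (ord3_cases i) => ->; rewrite !ord3_add !mxE; ring.
  - by apply: eqn; case: (ord3_cases i) => ->.
  - by apply: eqn; case: (ord3_cases i) => ->.
by exists r => //; split=> //; exact: homothety_triangle_region.
Qed.
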